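(* Every shortcut group is finitely presented.
   Context: Graphs are $1$-dimensional cell complexes with each edge isometric to $[0,1]$, with geodesic path metric $d_\Gamma$ (defined on all points, including interior points of edges). A cycle $C$ is a graph homeomorphic to a circle; $|C|$ is its number of edges. A cycle in a graph $\Gamma$ is a continuous map $f\colon C\to\Gamma$ sending vertices to vertices and each closed edge onto a closed edge (not necessarily injective). It is isometric if it is an isometric embedding. A connected simplicial graph $\Gamma$ is shortcut if there is $\theta\in\mathbb{N}$ such that every isometric cycle $C\to\Gamma$ has $|C|\le\theta$. A group is shortcut if it acts (by graph automorphisms) properly and cocompactly on a shortcut graph. *)

(* Defs.v *)
From HB Require Import structures.
From mathcomp Require Import all_boot all_order all_algebra.
From mathcomp Require Import all_classical all_reals all_analysis.
Import Order.TTheory GRing.Theory Num.Theory.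
Import numFieldNormedType.Exports.

Set Implicit Arguments.
Unset Strict Implicit.
Unset Printing Implicit Defensive.

Local Open Scope classical_set_scope.
Local Open Scope ring_scope.

(* The cells of a 1-dimensional cell complex.  Each edge comes with a
   parametrization, running from [src e] to [tgt e]; nothing below depends on
   the choice of its direction.  Loops and multiple edges are allowed, as they
   occur in the circles with one or two edges. *)
Record graph := Graph {
  vert : Type;
  edge : Type;
  src : edge -> vert;
  tgt : edge -> vert
}.

Definition simplicial (X : graph) : Prop :=
  (forall e : edge X, src e <> tgt e) /\
  (forall e e' : edge X,
     (src e = src e' /\ tgt e = tgt e') \/
     (src e = tgt e' /\ tgt e = src e') -> e = e').

(* The cell complex itself, as the disjoint union of its vertices and of its
   open edges. *)
Inductive gpoint (R : realType) (X : graph) : Type :=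
| Vertex of vert X
| Inner of edge X & {t : R | 0 < t < 1}.
Arguments Vertex R {X} _.
Arguments Inner {R X} _ _.

(* The characteristic map of [e]; only its values on [0, 1] are relevant. *)
Definition edge_map (R : realType) (X : graph) (e : edge X) (t : R) :
    gpoint R X :=
  if insub t is Some u then Inner e u
  else if t <= 0 then Vertex R (src e) else Vertex R (tgt e).

Definition closed_edge (R : realType) (X : graph) (e : edge X) :
    set (gpoint R X) :=
  edge_map e @` `[0, 1].

(* [pl_path x y l]: there is a piecewise linear path of length [l] from [x] to
   [y], i.e. a concatenation of segments, each contained in a closed edge. *)
Inductive pl_path (R : realType) (X : graph) :
    gpoint R X -> gpoint R X -> R -> Prop :=
| pl_nil x : pl_path x x 0
| pl_cons (e : edge X) (s t : R) y l :
    0 <= s <= 1 -> 0 <= t <= 1 -> pl_path (edge_map e t) y l ->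
    pl_path (edge_map e s) y (`|s - t| + l).

(* The path metric; points in different components are at distance +oo. *)
Definition gdist (R : realType) (X : graph) (x y : gpoint R X) : \bar R :=
  ereal_inf [set l%:E | l in [set l : R | pl_path x y l]].

Section MetricTopology.
Context (R : realType) (X : graph).
Implicit Types x y z : gpoint R X.

Lemma pl_path_ge0 x y l : pl_path x y l -> 0 <= l.
Proof. by elim=> // *; rewrite addr_ge0. Qed.

Lemma pl_path_cat x y z l m :
  pl_path x y l -> pl_path y z m -> pl_path x z (l + m).
Proof.
move=> xy; elim: xy m => [a|e s t b k s01 t01 _ IH] m yz; first by rewrite add0r.
by rewrite -addrA; apply: pl_cons => //; exact: IH.
Qed.

Lemma pl_path_sym x y l : pl_path x y l -> pl_path y x l.
Proof.
elim=> [a|e s t b k s01 t01 _ IH]; first exact: pl_nil.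
rewrite addrC; apply: pl_path_cat IH _.
by rewrite -[`|s - t|]addr0 distrC; apply: pl_cons => //; exact: pl_nil.
Qed.

Definition gball x (e : R) : set (gpoint R X) := [set y | (gdist x y < e%:E)%E].

Lemma gballP x (e : R) y : gball x e y <-> exists2 l, pl_path x y l & l < e.
Proof.
split=> [/ereal_inf_lt[_ [l xy <-]]|[l xy le]].
  by rewrite lte_fin => le; exists l.
by apply: (@le_lt_trans _ _ l%:E); [apply: ereal_inf_lbound; exists l|rewrite lte_fin].
Qed.

Let gball_center x (e : R) : 0 < e -> gball x e x.
Proof. by move=> e0; apply/gballP; exists 0 => //; exact: pl_nil. Qed.

Let gball_sym x y (e : R) : gball x e y -> gball y e x.
Proof.
by move=> /gballP[l xy le]; apply/gballP; exists l => //; exact: pl_path_sym.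
Qed.

Let gball_triangle x y z (e1 e2 : R) :
  gball x e1 y -> gball y e2 z -> gball x (e1 + e2) z.
Proof.
move=> /gballP[l xy le] /gballP[m yz me]; apply/gballP.
by exists (l + m); [exact: pl_path_cat yz|exact: ltrD].
Qed.

HB.instance Definition _ := gen_eqMixin (gpoint R X).
HB.instance Definition _ := gen_choiceMixin (gpoint R X).
HB.instance Definition _ :=
  hasNbhs.Build (gpoint R X) (nbhs_ (entourage_ gball)).
HB.instance Definition _ :=
  Nbhs_isPseudoMetric.Build R (gpoint R X)
    erefl gball_center gball_sym gball_triangle erefl.

End MetricTopology.

Definition unit_circle (R : realType) : set (R * R) :=
  [set p | p.1 ^+ 2 + p.2 ^+ 2 = 1].

Definition homeomorphic_to (T U : topologicalType) (A : set U) : Prop :=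
  exists (f : T -> U) (g : U -> T),
    [/\ continuous f, {within A, continuous g}, range f = A & cancel f g].

Definition circle_graph (R : realType) (C : graph) : Prop :=
  homeomorphic_to (gpoint R C) (@unit_circle R).

Definition graph_cycle (R : realType) (C X : graph)
    (f : gpoint R C -> gpoint R X) : Prop :=
  [/\ continuous f,
      forall v, exists w, f (Vertex R v) = Vertex R w &
      forall e, exists e', f @` closed_edge e = closed_edge e'].

Definition isometric (R : realType) (C X : graph)
    (f : gpoint R C -> gpoint R X) : Prop :=
  forall x y, gdist (f x) (f y) = gdist x y.

(* The library's [connected] holds of the empty set, which is excluded here. *)
Definition shortcut_graph (R : realType) (X : graph) : Prop :=
  [/\ [set: gpoint R X] !=set0, connected [set: gpoint R X], simplicial X &
      exists theta : nat,
        forall (C : graph) (f : gpoint R C -> gpoint R X),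
          circle_graph R C -> graph_cycle f -> isometric f ->
          ([set: edge C] #<= `I_theta)%card].

Definition graph_automorphism (R : realType) (X : graph)
    (phi : gpoint R X -> gpoint R X) : Prop :=
  [/\ bijective phi,
      forall v, exists w, phi (Vertex R v) = Vertex R w &
      forall e, exists e',
        {in `[0, 1], forall t, phi (edge_map e t) = edge_map e' t} \/
        {in `[0, 1], forall t, phi (edge_map e t) = edge_map e' (1 - t)}].

Section Actions.
Context (R : realType) (G : groupType) (X : graph).
Implicit Type act : G -> gpoint R X -> gpoint R X.

Definition graph_action act : Prop :=
  [/\ forall x, act 1%g x = x,
      forall g h x, act (g * h)%g x = act g (act h x) &
      forall g, graph_automorphism (act g)].

Definition proper_action act : Prop :=
  forall K : set (gpoint R X), compact K ->
    finite_set [set g : G | (act g @` K) `&` K !=set0].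

Definition cocompact_action act : Prop :=
  exists2 K : set (gpoint R X), compact K & \bigcup_g (act g @` K) = setT.

End Actions.

Definition shortcut_group (R : realType) (G : groupType) : Prop :=
  exists (X : graph) (act : G -> gpoint R X -> gpoint R X),
    [/\ shortcut_graph R X, graph_action act, proper_action act &
        cocompact_action act].

(* Words in the letters x and x^-1, for x in [X]; [(x, true)] stands for x^-1. *)
Definition word (X : Type) : Type := seq (X * bool).

(* Equality in the group presented by the generators [X] and the relators in
   [rels]: that group is the quotient of [word X] by [presented_eq rels]. *)
Inductive presented_eq (X : eqType) (rels : seq (word X)) :
    word X -> word X -> Prop :=
| peq_refl w : presented_eq rels w w
| peq_sym w w' : presented_eq rels w w' -> presented_eq rels w' w
| peq_trans w w' w'' :
    presented_eq rels w w' -> presented_eq rels w' w'' ->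
    presented_eq rels w w''
| peq_cancel u v x b :
    presented_eq rels (u ++ [:: (x, b); (x, ~~ b)] ++ v) (u ++ v)
| peq_relator u v r :
    r \in rels -> presented_eq rels (u ++ r ++ v) (u ++ v).

Definition eval_word (G : groupType) (X : Type) (s : X -> G) (w : word X) : G :=
  foldr (fun l g => (if l.2 then (s l.1)^-1 else s l.1) * g)%g 1%g w.

(* Evaluation at [s] induces an isomorphism from the presented group to [G]. *)
Definition finitely_presented (G : groupType) : Prop :=
  exists (n : nat) (rels : seq (word 'I_n)) (s : 'I_n -> G),
    (forall g, exists w, eval_word s w = g) /\
    (forall w w', eval_word s w = eval_word s w' <-> presented_eq rels w w').

(* Main.v *)
Require Import Defs.
From HB Require Import structures.
From mathcomp Require Import all_boot all_order all_algebra.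
From mathcomp Require Import all_classical all_reals all_analysis.
From mathcomp Require Import zify lra.

(** Let [G] act properly and cocompactly on a shortcut graph [X].  The argument
    has a geometric and an algebraic half, which meet in the notion of a
    shortcut of a closed edge path: a path [q] between two of its vertices that
    is strictly shorter than both arcs between them ([has_shortcut]).

    Geometry.  If a closed edge path with [n >= 3] edges has no shortcut, then
    the induced map from the [n]-gon to [X] preserves the distances between
    vertices, and therefore between all points, because a shortest route between
    two points of different open edges leaves each edge through one of its ends
    ([pl_path_route], [realize_isometric]).  The [n]-gon is a circle
    ([polygon_circle]), so the map is an isometric cycle and [n] is at most the
    constant of the shortcut graph.  Hence all sufficiently long closed edge
    paths have shortcuts ([closed_path_shortcut]).

    Algebra.  A shortcut cuts a closed path into closed paths that are strictly
    shorter.  By induction on the length, an assignment of group words to edge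
    paths that is trivial on the short closed paths is trivial on all of them
    ([closed_path_trivial]).  This is the simple connectedness of the complex
    obtained from [X] by filling the short closed paths, and the usual
    presentation of a group acting on such a complex applies.  By compactness
    and properness there is a finite set [F] of vertices whose translates cover
    the graph and which meets only finitely many of its translates.  Each vertex
    [v] lies in [pr v F] for a chosen element [pr v]; an edge from [u] to [v] is
    read as the generator [(pr u)^-1 (pr v)], and only finitely many elements
    arise.  As relators we take all words of bounded length that are trivial in
    [G].  They make the short closed paths trivial, hence all closed paths, and
    they suffice to replace each word by the word read along a path in [X]
    ([finitely_presented_of_shortcuts]). *)

Import Order.TTheory GRing.Theory Num.Theory.
Import numFieldNormedType.Exports.

Set Implicit Arguments.
Unset Strict Implicit.
Unset Printing Implicit Defensive.

Local Open Scope classical_set_scope.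

(** * Words and presented groups *)

Section PresentedGroup.
Context (X : eqType) (rels : seq (word X)).
Implicit Types w u v : word X.
Local Notation peq := (presented_eq rels).

Definition inv_word w : word X := rev [seq (l.1, ~~ l.2) | l <- w].

Lemma presented_eq_cat2 u v w w' : peq w w' -> peq (u ++ w ++ v) (u ++ w' ++ v).
Proof.
elim=> {w w'} [w|w w' _ IH|w1 w2 w3 _ IH12 _ IH23|a b x c|a b r rr].
- exact: peq_refl.
- exact: peq_sym.
- exact: peq_trans IH12 IH23.
- have := peq_cancel rels (u ++ a) (b ++ v) x c.
  by rewrite -!catA.
- have := peq_relator (u ++ a) (b ++ v) rr.
  by rewrite -!catA.
Qed.

Lemma presented_eq_cat w1 w1' w2 w2' :
  peq w1 w1' -> peq w2 w2' -> peq (w1 ++ w2) (w1' ++ w2').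
Proof.
move=> e1 e2; apply: peq_trans (_ : peq (w1' ++ w2) _).
  by have := presented_eq_cat2 [::] w2 e1.
by have := presented_eq_cat2 w1' [::] e2; rewrite !cats0.
Qed.

Lemma presented_eq_mulV w : peq (w ++ inv_word w) [::].
Proof.
elim: w => [|[x b] w IH]; first exact: peq_refl.
rewrite /inv_word /= rev_cons -cats1 -[_ :: _]cat1s.
have := presented_eq_cat2 [:: (x, b)] [:: (x, ~~ b)] IH.
rewrite /inv_word -!catA => h; apply: peq_trans h _ => /=.
exact: (peq_cancel rels [::] [::] x b).
Qed.

Lemma presented_eq_cancelr u v w : peq (u ++ w) (v ++ w) -> peq u v.
Proof.
have K a : peq ((a ++ w) ++ inv_word w) a.
  rewrite -catA -{2}[a]cats0.
  exact: presented_eq_cat (peq_refl _ _) (presented_eq_mulV _).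
move=> e; apply: peq_trans (peq_sym (K u)) _; apply: peq_trans (K v).
exact: presented_eq_cat e (peq_refl _ _).
Qed.

End PresentedGroup.

Section Evaluation.
Context (G : groupType) (X : eqType) (s : X -> G).
Implicit Types w u v : word X.
Local Open Scope group_scope.

Lemma eval_word_cat u v :
  eval_word s (u ++ v) = eval_word s u * eval_word s v.
Proof. by elim: u => [|l u IH] /=; rewrite ?mul1g// IH mulgA. Qed.

Lemma eval_word_inv w : eval_word s (inv_word w) = (eval_word s w)^-1.
Proof.
elim: w => [|[x b] w IH] /=; first by rewrite invg1.
rewrite /inv_word /= rev_cons -cats1 eval_word_cat IH invgM /= mulg1.
by case: b; rewrite ?invgK.
Qed.

Lemma presented_eq_eval (rels : seq (word X)) w w' :
  (forall r, r \in rels -> eval_word s r = 1) ->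
  presented_eq rels w w' -> eval_word s w = eval_word s w'.
Proof.
move=> r1; elim=> // {w w'} [w1 w2 w3 _ -> _ ->//|u v x b|u v r rr].
  rewrite !eval_word_cat /= mulg1; case: b => /=;
  by rewrite ?mulVg ?mulgV ?mul1g.
by rewrite !eval_word_cat (r1 _ rr) mul1g.
Qed.

End Evaluation.

Section ShortRelators.
Context (G : groupType) (X : finType) (s : X -> G) (L : nat).

(** Taking all short words that are trivial in [G], instead of a list of
    specific relators, makes any two short words with the same value
    equivalent ([short_presented_eq]), so that no relator has to be derived
    by hand. *)
Definition short_relators : seq (word X) :=
  [seq w <- flatten [seq [seq val t | t <- enum {: k.-tuple (X * bool)%type}]
                    | k <- iota 0 L.+1] | eval_word s w == 1%g].

Lemma mem_short_relators w :
  (w \in short_relators) = (size w <= L)%N && (eval_word s w == 1%g).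
Proof.
rewrite mem_filter andbC; congr andb; apply/flatten_mapP/idP => [[k]|wL].
  by rewrite mem_iota add0n => kL /mapP[t _ ->]; rewrite size_tuple.
exists (size w); first by rewrite mem_iota.
by apply/mapP; exists (in_tuple w); rewrite ?mem_enum.
Qed.

Lemma short_presented_eq w w' : (size w + size w' <= L)%N ->
  eval_word s w = eval_word s w' -> presented_eq short_relators w w'.
Proof.
move=> wL e; apply: (@presented_eq_cancelr _ _ _ _ (inv_word w')).
apply: peq_trans (peq_sym (presented_eq_mulV _ _)).
rewrite -[w ++ _]cats0 -[w ++ _]cat0s -catA.
apply: (peq_relator [::] [::]).
rewrite mem_short_relators size_cat size_rev size_map wL /=.
by rewrite eval_word_cat eval_word_inv e mulgV.
Qed.

End ShortRelators.

(** * Contracting closed paths along shortcuts *)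

Section Contraction.
Context (V : Type) (e : rel V) (e_sym : forall u v, e u v -> e v u).

Lemma path_reverse u p : path e u p -> exists q,
  [/\ path e (last u p) q, last (last u p) q = u & size q = size p].
Proof using e_sym.
move=> up; exists (rev (belast u p)); split.
- by rewrite rev_path; apply: sub_path up => a b /= /e_sym.
- by case: (p) => //= v q; rewrite rev_cons last_rcons.
- by rewrite size_rev size_belast.
Qed.

(** Here [p] is meant to be closed at [x], so that the two arcs between the ends
    of [q] are [p2] and [p3 ++ p1]. *)
Definition has_shortcut (x : V) (p : seq V) : Prop :=
  exists p1 p2 p3 q, [/\ p = p1 ++ p2 ++ p3,
    path e (last x p1) q, last (last x p1) q = last x (p1 ++ p2) &
    (size q < minn (size p2) (size p1 + size p3))%N].

Context (X : eqType) (rels : seq (word X)) (label : V -> V -> word X).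

Fixpoint path_word (u : V) (p : seq V) : word X :=
  if p is v :: p' then label u v ++ path_word v p' else [::].

Lemma path_word_cat u p q :
  path_word u (p ++ q) = path_word u p ++ path_word (last u p) q.
Proof. by elim: p u => //= v p IH u; rewrite IH catA. Qed.

(** A shortcut [q] of the closed path [p1 p2 p3], with reverse [r], yields the
    closed paths [p2 r], [q r] and [p1 q p3], which are all shorter.  The first
    two show that [p2] and [q] read the same element, and then the third one
    reads the same element as the given path.  Going through [q r] dispenses
    with any relation between the labels of an edge and of its reverse. *)
Lemma closed_path_trivial (N : nat) :
  (forall x p, path e x p -> last x p = x -> (size p <= N)%N ->
     presented_eq rels (path_word x p) [::]) ->
  (forall x p, path e x p -> last x p = x -> (N < size p)%N ->
     has_shortcut x p) ->
  forall x p, path e x p -> last x p = x ->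
    presented_eq rels (path_word x p) [::].
Proof using e_sym.
move=> short shortcut x p; have [k] := ubnP (size p).
elim: k x p => // k IH x p; rewrite ltnS => pk xp lxp.
case: (leqP (size p) N) => [pN|Np]; first exact: short.
have [p1 [p2 [p3 [q [pE xq lq]]]]] := shortcut x p xp lxp Np.
rewrite leq_min => /andP[q2 q13].
move: xp lxp pk; rewrite pE !cat_path !last_cat !size_cat in lq *.
set y := last x p1 in lq xq *; set z := last y p2 in lq *.
move=> /and3P[xp1 yp2 zp3] lp3 pk.
have [r] := path_reverse xq; rewrite lq => -[zr lr sr].
have p2r : presented_eq rels (path_word y p2 ++ path_word z r) [::].
  rewrite -path_word_cat; apply: IH;
    rewrite ?size_cat ?cat_path ?last_cat -/z ?yp2//.
  by rewrite sr; lia.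
have qr : presented_eq rels (path_word y q ++ path_word z r) [::].
  rewrite -lq -path_word_cat; apply: IH;
    rewrite ?size_cat ?cat_path ?last_cat ?xq ?lq//.
  by rewrite sr; lia.
have p2q : presented_eq rels (path_word y p2) (path_word y q).
  apply: (@presented_eq_cancelr _ _ _ _ (path_word z r)).
  exact: peq_trans p2r (peq_sym qr).
have p1qp3 :
    presented_eq rels (path_word x p1 ++ path_word y q ++ path_word z p3) [::].
  rewrite -lq -path_word_cat -path_word_cat; apply: IH.
  - by rewrite !size_cat; lia.
  - by rewrite !cat_path xp1 xq lq zp3.
  - by rewrite !last_cat lq.
rewrite !path_word_cat -/y -/z; apply: peq_trans p1qp3.
exact: presented_eq_cat2.
Qed.

End Contraction.

(** * Finite presentation from an action on a set of vertices *)

Section Presentation.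
Context (G : groupType) (V : Type) (act : G -> V -> V) (e : rel V).
Local Open Scope group_scope.

(** The set [F] plays the part of a compact fundamental domain: its translates
    cover all vertices and all edges, and only finitely many of them meet [F].
    Properness of the action enters through the latter alone. *)
Lemma finitely_presented_of_shortcuts (F : set V) (x0 : V) (N : nat) :
  (forall x, act 1 x = x) -> (forall g h x, act (g * h) x = act g (act h x)) ->
  (forall u v, e u v -> e v u) ->
  (forall g u v, e u v -> e (act g u) (act g v)) ->
  (forall u v, exists2 p, path e u p & last u p = v) ->
  finite_set [set g | exists a b, [/\ F a, F b & act g a = b]] ->
  F x0 ->
  (forall v, exists g a, F a /\ act g a = v) ->
  (forall u v, e u v ->
     exists g a b, [/\ F a, F b, act g a = u & act g b = v]) ->
  (forall x p, path e x p -> last x p = x -> (N < size p)%N ->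
     has_shortcut e x p) ->
  finitely_presented G.
Proof.
move=> act1 actM eC eG conn finT Fx0 covV covE shortcut.
set T := [set g | _] in finT.
have T1 : T 1 by exists x0, x0.
(* If [g] carries two points of [F] to the ends [u] and [v] of an edge, then
   [(pr u)^-1 g] and [g^-1 (pr v)] lie in [T], and their product labels it. *)
have /finite_seqP[ss Sss] : finite_set [set x.1 * x.2 | x in T `*` T].
  by apply: finite_image; exact: finite_setX.
have {}Sss a b : T a -> T b -> a * b \in ss.
  move=> Ta Tb; suff : [set` ss] (a * b) by [].
  by rewrite -Sss; exists (a, b).
have TS a : T a -> a \in ss by move=> Ta; rewrite -[a]mulg1; exact: Sss.
have [pr prP] : {pr : V -> G & forall v, exists2 a, F a & act (pr v) a = v}.
  apply: (@choice _ _ (fun v g => exists2 a, F a & act g a = v)) => v.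
  by have [g [a [Fa <-]]] := covV v; exists g; exists a.
have edgeS u v : e u v -> (pr u)^-1 * pr v \in ss.
  move=> /covE[g [a [b [Fa Fb gu gv]]]].
  have [a' Fa' pu] := prP u; have [b' Fb' pv] := prP v.
  rewrite -[pr v](mulVKg g) mulgA; apply: Sss.
    by exists a, a'; rewrite actM gu -{2}pu -actM mulVg act1.
  by exists b', b; rewrite actM pv -{1}gv -actM mulVg act1.
have baseS g : g^-1 * pr (act g x0) \in ss.
  apply: TS; have [a Fa pa] := prP (act g x0).
  by exists a, x0; rewrite actM pa -actM mulVg act1.
set n := size ss.
have n0 : (0 < n)%N by rewrite lt0n size_eq0; apply: contraTneq (TS _ T1) => ->.
set s := fun i : 'I_n => nth 1 ss i.
have letter g : {i : 'I_n | g \in ss -> s i = g}.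
  case: (boolP (g \in ss)) => [gss|_]; last by exists (Ordinal n0).
  have h : (index g ss < n)%N by rewrite index_mem.
  by exists (Ordinal h) => _; rewrite /s /= nth_index.
pose lt g : word 'I_n := [:: (proj1_sig (letter g), false)].
have evlt g : g \in ss -> eval_word s (lt g) = g.
  by move=> gss; rewrite /= (proj2_sig (letter g))// mulg1.
pose W := path_word (fun u v => lt ((pr u)^-1 * pr v)).
have Wcat u p q : W u (p ++ q) = W u p ++ W (last u p) q by exact: path_word_cat.
have sizeW p u : size (W u p) = size p.
  by elim: p u => //= v p IH u; rewrite IH.
have evW p u : path e u p -> eval_word s (W u p) = (pr u)^-1 * pr (last u p).
  elim: p u => [|v p IH] u; first by rewrite /= mulVg.
  move=> /= /andP[/edgeS uv vp].
  by rewrite IH// (proj2_sig (letter _))// mulgA mulgK.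
have pathL (l : 'I_n * bool) : {p : seq V | path e x0 p &
    last x0 p = act (eval_word s [:: l]) x0}.
  by apply: cid2; have [p] := conn x0 (act (eval_word s [:: l]) x0); exists p.
pose ell l := size (s2val (pathL l)).
(* Relators up to length [N] contract the short closed paths.  Those up to
   length [ell l + 3] compare the letter [l] with the word read along a path
   of length [ell l]; the other three letters are [l] itself and the two letters
   [h] that move between the base point and the chosen representatives. *)
pose L := (N + \max_l ell l + 3)%N.
have LN : (N <= L)%N by rewrite /L -addnA leq_addr.
have Lell l : (ell l + 3 <= L)%N.
  by rewrite leq_add2r (leq_trans (leq_bigmax l)) ?leq_addl.
pose rels := short_relators s L.
have relP r : r \in rels -> eval_word s r = 1.
  by rewrite mem_short_relators => /andP[_ /eqP].
have geo g p u : path e u p -> path e (act g u) (map (act g) p).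
  elim: p u => //= v p IH u /andP[uv vp].
  by rewrite IH// andbT; exact: eG.
have loop x p : path e x p -> last x p = x -> presented_eq rels (W x p) [::].
  apply: (closed_path_trivial eC _ shortcut) => {}x {}p xp lxp pN; rewrite -/(W x p).
  apply: short_presented_eq; first by rewrite sizeW addn0 (leq_trans pN).
  by rewrite evW// lxp mulVg.
pose h g := lt (g^-1 * pr (act g x0)).
(* The path of [w] based at [act g x0] is the concatenation of translates of
   the paths of its letters. *)
have trace w g : exists p, [/\ path e (act g x0) p,
    last (act g x0) p = act (g * eval_word s w) x0 &
    presented_eq rels (w ++ h (g * eval_word s w)) (h g ++ W (act g x0) p)].
  elim: w g => [|l w IH] g.
    by exists [::]; rewrite /= mulg1; split=> //; exact: peq_refl.
  set a := eval_word s [:: l].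
  have aE : eval_word s (l :: w) = a * eval_word s w.
    by rewrite /a -cat1s eval_word_cat.
  have [p [xp lp ep]] := IH (g * a).
  case ql: (pathL l) => [q xq lq].
  have lq' : last (act g x0) (map (act g) q) = act (g * a) x0.
    by rewrite last_map lq -actM.
  exists (map (act g) q ++ p); rewrite aE mulgA cat_path last_cat lq' geo//.
  split=> //; rewrite Wcat lq' -cat1s -catA.
  apply: peq_trans (_ : presented_eq rels
      ([:: l] ++ h (g * a) ++ W (act (g * a) x0) p) _).
    exact: presented_eq_cat (peq_refl _ _) ep.
  rewrite !catA; apply: presented_eq_cat (peq_refl _ _).
  apply: short_presented_eq.
    rewrite !size_cat sizeW size_map /=.
    by have := Lell l; rewrite {1}/ell ql /=; lia.
  rewrite !eval_word_cat evW ?geo// lq' !evlt ?baseS// -/a.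
  by rewrite invgM !mulgA mulgV mul1g mulgK.
have triv w : eval_word s w = 1 -> presented_eq rels w [::].
  move=> w1; have [p [xp lp]] := trace w 1.
  rewrite w1 mulg1 act1 in xp lp * => ep.
  apply: (@presented_eq_cancelr _ _ _ _ (h 1)); apply: peq_trans ep _.
  rewrite cat0s -[X in presented_eq _ _ X]cats0.
  exact: presented_eq_cat (peq_refl _ _) (loop _ _ xp lp).
exists n, rels, s; split=> [g|w w'].
  have [p xp lp] := conn x0 (act g x0).
  exists (h 1 ++ W x0 p ++ inv_word (h g)).
  rewrite !eval_word_cat evW// eval_word_inv !evlt ?baseS// lp act1.
  by rewrite invg1 mul1g invgM invgK !mulgA mulgV mul1g mulgV mul1g.
split=> [ww'|]; last exact: presented_eq_eval.
apply: (@presented_eq_cancelr _ _ _ _ (inv_word w')).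
apply: peq_trans (peq_sym (presented_eq_mulV _ _)).
by apply: triv; rewrite eval_word_cat eval_word_inv ww' mulgV.
Qed.

End Presentation.

Local Open Scope ring_scope.

(** * Edge paths and the path metric *)

Section Walks.
Context (X : graph).

(** Edges are traversed in both directions, whatever their parametrization. *)
Definition joined (u v : vert X) : Prop :=
  exists e : edge X, (src e = u /\ tgt e = v) \/ (src e = v /\ tgt e = u).

Definition adjb : rel (vert X) := [rel u v | `[< joined u v >]].

Definition walk (u v : vert X) (k : nat) : Prop :=
  exists p, [/\ path adjb u p, last u p = v & size p = k].

Lemma joined_sym u v : joined u v -> joined v u.
Proof. by move=> [e [[? ?]|[? ?]]]; exists e; [right|left]. Qed.

Lemma walk0 u : walk u u 0.
Proof. by exists [::]. Qed.

Lemma walk1 u v : joined u v -> walk u v 1.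
Proof. by move=> uv; exists [:: v]; split=> //=; rewrite andbT; apply/asboolP. Qed.

Lemma walk_cat u v w k l : walk u v k -> walk v w l -> walk u w (k + l).
Proof.
move=> [p [up <- <-]] [q [vq <- <-]]; exists (p ++ q).
by rewrite cat_path last_cat size_cat up vq.
Qed.

Lemma adjb_sym u v : adjb u v -> adjb v u.
Proof. by move=> /asboolP/joined_sym/asboolP. Qed.

Lemma walk_sym u v k : walk u v k -> walk v u k.
Proof.
move=> [p [up <- <-]].
by have [q [vq lq sq]] := path_reverse adjb_sym up; exists q.
Qed.

End Walks.

Section Segments.
Context (R : realType) (X : graph).
Implicit Types (x y z w : gpoint R X) (e : edge X) (s t : R).

Variant edge_map_spec e : R -> gpoint R X -> Prop :=
| EdgeMapSrc : edge_map_spec e 0 (Vertex R (src e))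
| EdgeMapTgt : edge_map_spec e 1 (Vertex R (tgt e))
| EdgeMapInner (u : {t : R | 0 < t < 1}) : edge_map_spec e (val u) (Inner e u).

Lemma edge_map0 e : edge_map e 0 = Vertex R (src e).
Proof. by rewrite /edge_map insubF ?lexx// ltxx. Qed.

Lemma edge_map1 e : edge_map e 1 = Vertex R (tgt e).
Proof. by rewrite /edge_map insubF ?ltxx ?andbF// lt_geF. Qed.

Lemma edge_map_val e (u : {t : R | 0 < t < 1}) : edge_map e (val u) = Inner e u.
Proof. by rewrite /edge_map valK. Qed.

Lemma edge_mapP e t : 0 <= t <= 1 -> edge_map_spec e t (edge_map e t).
Proof.
move=> /andP[]; rewrite le_eqVlt => /predU1P[<- _|t0].
  by rewrite edge_map0; exact: EdgeMapSrc.
rewrite le_eqVlt => /predU1P[->|t1]; first by rewrite edge_map1; exact: EdgeMapTgt.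
have t01 : 0 < t < 1 by rewrite t0.
by rewrite -[t]/(val (exist _ t t01 : {t : R | 0 < t < 1})) edge_map_val; exact: EdgeMapInner.
Qed.

Lemma pl_edge e s t : 0 <= s <= 1 -> 0 <= t <= 1 ->
  pl_path (edge_map e s) (edge_map e t) `|s - t|.
Proof.
by move=> s01 t01; rewrite -[`|_|]addr0; apply: pl_cons => //; exact: pl_nil.
Qed.

Lemma gdist_le x y l : pl_path x y l -> (gdist x y <= l%:E)%E.
Proof. by move=> xyl; apply: ereal_inf_lbound; exists l. Qed.

(** The partial edges at both ends of a route.  A vertex has only the trivial
    one, so that an edge that is followed from a vertex counts as part of the
    edge path of the route. *)
Variant stub : gpoint R X -> vert X -> R -> Prop :=
| StubVertex a : stub (Vertex R a) a 0
| StubSrc e u : stub (Inner e u) (src e) (val u)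
| StubTgt e u : stub (Inner e u) (tgt e) (1 - val u).

(** The two shapes of a shortest path between points: it stays inside one
    open edge, or it leaves the edges of both points through one of their
    ends and follows an edge path in between.  The real part of the length
    sits in the two stubs, the rest is a number of edges. *)
Variant route x y (l : R) : Prop :=
| SameEdge e u v of x = Inner e u & y = Inner e v & `|val u - val v| <= l
| ThroughVertices a b al be k of stub x a al & stub y b be & walk a b k
    & al + k%:R + be <= l.

Lemma inner_itv (u : {t : R | 0 < t < 1}) : 0 < val u < 1.
Proof. by case: u => t t01; exact: t01. Qed.

Lemma route_sym x y l : route x y l -> route y x l.
Proof.
case=> [e u v -> -> uvl|a b al be k xa yb ab le_l].
  by apply: SameEdge => //; rewrite distrC.
by apply: (ThroughVertices yb xa (walk_sym ab)); lra.
Qed.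

Lemma route_edge e s t : 0 <= s <= 1 -> 0 <= t <= 1 ->
  route (edge_map e s) (edge_map e t) `|s - t|.
Proof.
have st : joined (src e) (tgt e) by exists e; left.
have w0 := @walk0 X; have wst := walk1 st; have wts := walk_sym wst.
move=> /edge_mapP-[||u] /edge_mapP-[||v].
- by apply: ThroughVertices (StubVertex _) (StubVertex _) (w0 _) _; rewrite subrr normr0 !addr0.
- by apply: ThroughVertices (StubVertex _) (StubVertex _) wst _; rewrite sub0r normrN normr1; lra.
- have := inner_itv v => v01.
  apply: ThroughVertices (StubVertex _) (StubSrc _ _) (w0 _) _.
  by rewrite distrC subr0 ger0_norm; lra.
- by apply: ThroughVertices (StubVertex _) (StubVertex _) wts _; rewrite subr0 normr1; lra.
- by apply: ThroughVertices (StubVertex _) (StubVertex _) (w0 _) _; rewrite subrr normr0 !addr0.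
- have := inner_itv v => v01.
  apply: ThroughVertices (StubVertex _) (StubTgt _ _) (w0 _) _.
  by rewrite ger0_norm; lra.
- have := inner_itv u => u01.
  apply: ThroughVertices (StubSrc _ _) (StubVertex _) (w0 _) _.
  by rewrite ger0_norm; lra.
- have := inner_itv u => u01.
  apply: ThroughVertices (StubTgt _ _) (StubVertex _) (w0 _) _.
  by rewrite distrC ger0_norm; lra.
- exact: SameEdge.
Qed.

Lemma stub_shift e (u v : {t : R | 0 < t < 1}) a al : stub (Inner e v) a al ->
  exists2 al', stub (Inner e u) a al' & al' <= `|val u - val v| + al.
Proof.
move ez : (Inner e v) => z sz; case: sz ez => // e' v' [<- ->].
  exists (val u); first exact: StubSrc.
  by have := ler_norm (val u - val v'); lra.
exists (1 - val u); first exact: StubTgt.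
by have := ler_norm (val v' - val u); rewrite distrC; lra.
Qed.

Lemma stub_ge0 x a al : stub x a al -> 0 <= al.
Proof. by case=> // e u; have := inner_itv u; lra. Qed.

(** Arriving at a point from one end of its edge and leaving through the same
    end can be cut out; leaving through the other end has traversed the whole
    edge. *)
Lemma stub_stub x a b al be : stub x a al -> stub x b be ->
  exists2 k, walk a b k & k%:R <= al + be.
Proof.
move=> sa sb; have := stub_ge0 sa; have := stub_ge0 sb.
case: sa sb => [c|e u|e u]; move ez : (X in stub X) => z' sz; case: sz ez => //.
- by move=> d [->] _ _; exists 0%N; [exact: walk0|rewrite addr0].
- by move=> e' u' [<- <-] ? ?; exists 0%N; [exact: walk0|lra].
- move=> e' u' [<- <-] ? ?; exists 1%N; last by lra.
  by apply: walk1; exists e; left.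
- move=> e' u' [<- <-] ? ?; exists 1%N; last by lra.
  by apply: walk1; exists e; right.
- by move=> e' u' [<- <-] ? ?; exists 0%N; [exact: walk0|lra].
Qed.

Lemma route_cat x y z l m :
  route x y l -> route y z m -> route x z (l + m).
Proof.
have aux p q r l' m' (e : edge X) u v : p = Inner e u -> q = Inner e v ->
    `|val u - val v| <= l' -> route q r m' -> route p r (l' + m').
  move=> -> -> uvl [e' v' w [<- <-] -> vwm|a b al be k sa sb ab albe].
    apply: SameEdge => //; apply: le_trans (ler_distD (val v) _ _) _; lra.
  have [al' sal' ?] := stub_shift u sa.
  by apply: ThroughVertices sal' sb ab _; lra.
case=> [e u v xe ye uvl|a b al be k sa sb ab albe]; first exact: aux xe ye uvl.
case=> [e v w ye ze vwm|a' b' al' be' k' sa' sb' ab' albe'].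
  apply: route_sym; rewrite addrC.
  apply: (aux _ _ _ _ _ _ _ _ ze ye); first by rewrite distrC.
  apply: route_sym; exact: ThroughVertices sa sb ab albe.
have [j ba' jle] := stub_stub sb sa'.
apply: ThroughVertices sa sb' (walk_cat ab (walk_cat ba' ab')) _.
by rewrite !natrD; lra.
Qed.

(** All lower bounds on the path metric come from here: a piecewise linear
    path is at least as long as a route of one of the two standard shapes. *)
Lemma pl_path_route x y l : pl_path x y l -> route x y l.
Proof.
elim=> [[v|e u]|e s t z m s01 t01 _ IH].
- apply: ThroughVertices (StubVertex _) (StubVertex _) (walk0 _) _.
  by rewrite !addr0.
- by apply: (SameEdge (erefl _) (erefl _)); rewrite subrr normr0.
- exact: route_cat (route_edge e s01 t01) IH.
Qed.

Lemma stub_pl_path x a al : stub x a al -> pl_path x (Vertex R a) al.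
Proof.
case=> [v|e u|e u]; first exact: pl_nil.
  rewrite -edge_map_val -edge_map0 -{2}[val u]ger0_norm; last by have := inner_itv u; lra.
  by rewrite -{2}[val u]subr0; apply: pl_edge; have := inner_itv u; lra.
rewrite -edge_map_val -edge_map1 -[1 - _]ger0_norm; last by have := inner_itv u; lra.
by rewrite distrC; apply: pl_edge; have := inner_itv u; lra.
Qed.

Lemma walk_pl_path (a b : vert X) k :
  walk a b k -> pl_path (Vertex R a) (Vertex R b) k%:R.
Proof.
move=> [p [ap <- <-]] {b k}; elim: p a ap => [|c p IH] a /=.
  by move=> _; exact: pl_nil.
move=> /andP[/asboolP[e eac] /IH]; rewrite -natr1 addrC; apply: pl_path_cat.
case: eac => -[<- <-]; rewrite -edge_map0 -edge_map1.
  have := @pl_edge e 0 1; rewrite distrC subr0 normr1 !lexx ler01; exact.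
have := @pl_edge e 1 0; rewrite subr0 normr1 !lexx ler01; exact.
Qed.

Lemma route_vertex (a b : vert X) l :
  route (Vertex R a) (Vertex R b) l -> exists2 k, walk a b k & k%:R <= l.
Proof.
case=> [//|a' b' al be k]; move ex : (Vertex R a) => x xa; case: xa ex => // _ [<-].
move ey : (Vertex R b) => y yb; case: yb ey => // _ [<-] abk.
by rewrite add0r addr0; exists k.
Qed.

Definition half_param : {t : R | 0 < t < 1}.
Proof. by exists (1 / 2); lra. Defined.

Definition midpoint e : gpoint R X := Inner e half_param.

Lemma edge_map_half e : edge_map e (1 / 2) = midpoint e.
Proof. exact: (edge_map_val e half_param). Qed.

(** A route between the midpoints of two edges has two stubs of length [1/2].
    This separation makes a compact set contain only finitely many midpoints
    ([finite_separated]), and likewise for vertices. *)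
Lemma gball_midpoint e e' : gball (midpoint e) 1 (midpoint e') -> e = e'.
Proof.
have stub_mid x a al : stub x a al -> x = midpoint e \/ x = midpoint e' -> al = 1 / 2.
  by case=> [v []//|c u [] [_ ->]//|c u [] [_ ->]]; rewrite /= ; lra.
move=> /gballP[l /pl_path_route[_ _ _ [<- _] [<- _] //|a b al be k sa sb _ le_l l1]].
have := stub_mid _ _ _ sa (or_introl erefl).
have := stub_mid _ _ _ sb (or_intror erefl).
by have := ler0n R k => *; exfalso; lra.
Qed.

Lemma gball_vertex (a b : vert X) : gball (Vertex R a) 1 (Vertex R b) -> a = b.
Proof.
move=> /gballP[l /pl_path_route/route_vertex[k [p [_ <- <-]] kl] l1].
by case: p kl => //= c p; rewrite -natr1 => kl; have := ler0n R (size p) => ?; exfalso; lra.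
Qed.

Lemma open_pl_component x : open [set y : gpoint R X | exists l, pl_path x y l].
Proof.
rewrite openE => y [l xy]; rewrite /interior; apply/nbhs_ballP.
exists 1 => //= z /gballP[m yz _]; exists (l + m); exact: pl_path_cat yz.
Qed.

(** The set of points that are reached from [x] contains the unit ball around
    each of its points, and so does its complement. *)
Lemma connected_pl_path : connected [set: gpoint R X] ->
  forall x y, exists l, pl_path x y l.
Proof.
move=> cX x y; set B := [set y : gpoint R X | exists l, pl_path x y l].
suff : B = [set: gpoint R X] by move=> BT; have : B y by rewrite BT.
apply: cX.
- by exists x, 0; exact: pl_nil.
- by exists B; [exact: open_pl_component|rewrite setTI].
exists B; last by rewrite setTI.
rewrite -openC openE => z xz; rewrite /interior; apply/nbhs_ballP.
exists 1 => //= w /gballP[m zw _] [l xw]; apply: xz.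
by exists (l + m); apply: pl_path_cat xw (pl_path_sym zw).
Qed.

Lemma connected_walk : connected [set: gpoint R X] ->
  forall u v : vert X, exists k, walk u v k.
Proof.
move=> /connected_pl_path cX u v.
by have [l /pl_path_route/route_vertex[k uvk _]] := cX (Vertex R u) (Vertex R v); exists k.
Qed.

(** * Compactness and continuity *)

(** The bound is asked along each piecewise linear path, which is how maps
    out of a graph are estimated; the slack [d] avoids an infimum over paths. *)
Lemma lipschitz_continuous (T : pseudoMetricType R) (f : gpoint R X -> T) (K : R) :
  0 < K ->
  (forall x y l d, pl_path x y l -> l < d -> ball (f x) (K * d) (f y)) ->
  continuous f.
Proof.
move=> K0 fK x; have FF : Filter (nbhs x) := @topology_structure.nbhs_filter (gpoint R X) x.
apply/(@cvg_ballP _ _ _ _ FF) => eps eps0.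
apply/nbhs_ballP; exists (eps / K) => /=; first exact: divr_gt0.
move=> y /gballP[l xy le]; have := fK _ _ _ _ xy le.
by rewrite mulrC divfK// gt_eqF.
Qed.

(** If infinitely many of the points [m a] were in [K], the filter of the
    sets that contain all but finitely many of them would have a cluster
    point in [K], and two of the points would lie in the ball of radius [1/2]
    around it. *)
Lemma finite_separated (A : Type) (m : A -> gpoint R X) (K : set (gpoint R X)) :
  (forall a b, gball (m a) 1 (m b) -> a = b) -> compact K ->
  finite_set [set a | K (m a)].
Proof.
move=> sep cK; set S := [set a | K (m a)]; apply: contrapT => infS.
pose F : set_system (gpoint R X) := [set B | finite_set (S `\` m @^-1` B)].
have FF : ProperFilter F.
  split; first by rewrite /F /= preimage_set0 setD0.
  split; first by rewrite /F /= preimage_setT setDT; exact: finite_set0.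
    move=> B C; rewrite /F /= preimage_setI setDIr => fB fC.
    by rewrite finite_setU.
  move=> B C BC; apply: sub_finite_set => a [Sa nC]; split=> // Ba.
  exact: nC (BC _ Ba).
have [|p [_ clp]] := cK F FF.
  by apply: sub_finite_set (@finite_set0 A) => a [].
have near_p : nbhs p (gball p (1 / 2)).
  by apply/nbhs_ballP; exists (1 / 2) => //=; lra.
have meets a0 : exists a, S a /\ a <> a0 /\ gball p (1 / 2) (m a).
  have [|_ [[a [Sa aa0] <-] pa]] := clp (m @` (S `\ a0)) _ _ near_p.
    apply: sub_finite_set (finite_set1 a0) => a [Sa /= na].
    by apply: contrapT => aa0; apply: na; exists a.
  by exists a.
have [a0 _] : S !=set0.
  by apply/set0P/eqP => S0; apply: infS; rewrite S0; exact: finite_set0.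
have [a [_ [_ pa]]] := meets a0; have [b [_ [ba pb]]] := meets a.
apply: ba; apply: sep; rewrite [X in gball _ X _](_ : 1 = 1 / 2 + 1 / 2); last by lra.
by apply: (@ball_triangle _ _ p) => //; exact: ball_sym.
Qed.

End Segments.

Section ClosedEdges.
Context (R : realType) (X : graph).

Lemma edge_map_le0 (e : edge X) (t : R) : t <= 0 -> edge_map e t = Vertex R (src e).
Proof. by move=> t0; rewrite /edge_map insubF ?t0// le_gtF. Qed.

Lemma edge_map_ge1 (e : edge X) (t : R) : 1 <= t -> edge_map e t = Vertex R (tgt e).
Proof.
move=> t1; rewrite /edge_map insubF; last by rewrite [t < 1]le_gtF// andbF.
by rewrite lt_geF// (lt_le_trans ltr01).
Qed.

(** Outside of [0, 1] the map [edge_map e] is constant, so that it is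
    [edge_map e] composed with the retraction [cl] of the line onto [0, 1]. *)
Lemma edge_map_continuous (e : edge X) : continuous (@edge_map R X e).
Proof.
pose cl (t : R) := if t <= 0 then 0 else if 1 <= t then 1 else t.
have cl01 t : 0 <= cl t <= 1.
  by rewrite /cl; case: (lerP t 0) => ?; [|case: (lerP 1 t) => ?]; lra.
have clE t : edge_map e t = edge_map e (cl t).
  rewrite /cl; case: (lerP t 0) => ?; first by rewrite edge_map0 edge_map_le0.
  by case: (lerP 1 t) => // ?; rewrite edge_map1 edge_map_ge1.
have cl_le s t : `|cl s - cl t| <= `|s - t|.
  have := ler_norm (s - t); have := ler_norm (t - s); rewrite distrC ler_norml /cl.
  by case: (lerP s 0) => ?; case: (lerP t 0) => ?; try case: (lerP 1 s) => ?;
    try case: (lerP 1 t) => ?; lra.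
move=> s; apply/cvg_ballP => eps eps0; apply/nbhs_ballP; exists eps => //= t st.
apply/gballP; exists `|cl s - cl t|; last exact: le_lt_trans (cl_le _ _) st.
by rewrite (clE s) (clE t); exact: pl_edge.
Qed.

Lemma compact_closed_edge (e : edge X) : compact (@closed_edge R X e).
Proof.
apply: continuous_compact; last exact: segment_compact.
by apply: continuous_subspaceT; exact: edge_map_continuous.
Qed.

End ClosedEdges.

(** * Graph maps and their geometric realization *)

Section Realization.
Context (R : realType) (C X : graph).
Context (f : vert C -> vert X) (fe : edge C -> edge X) (rv : edge C -> bool).

(** The flag [rv i] records that [fe i] is parametrized against the direction
    of [i]. *)
Definition preserves_ends : Prop := forall i,
  if rv i then src (fe i) = f (tgt i) /\ tgt (fe i) = f (src i)
  else src (fe i) = f (src i) /\ tgt (fe i) = f (tgt i).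

Definition flip (b : bool) (t : R) : R := if b then 1 - t else t.

Definition realize (x : gpoint R C) : gpoint R X :=
  match x with
  | Vertex v => Vertex R (f v)
  | Inner i u => edge_map (fe i) (flip (rv i) (val u))
  end.

Lemma flip01 b t : 0 <= t <= 1 -> 0 <= flip b t <= 1.
Proof. by case: b => /=; lra. Qed.

Lemma flipK b : involutive (flip b).
Proof. by case: b => t //=; lra. Qed.

Lemma flip_dist b s t : `|flip b s - flip b t| = `|s - t|.
Proof. by case: b => //=; rewrite distrC; congr `|_|; lra. Qed.

Context (ends : preserves_ends).

Lemma realize_edge_map i t : 0 <= t <= 1 ->
  realize (edge_map i t) = edge_map (fe i) (flip (rv i) t).
Proof.
move=> /edge_mapP-[||u] //=; have := ends i; rewrite /flip.
  by case: (rv i) => -[se te]; rewrite ?subr0 ?edge_map1 ?edge_map0 ?se ?te.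
by case: (rv i) => -[se te]; rewrite ?subrr ?edge_map1 ?edge_map0 ?se ?te.
Qed.

Lemma realize_pl_path x y l :
  pl_path x y l -> pl_path (realize x) (realize y) l.
Proof.
elim=> [z|i s t z m s01 t01 _]; first exact: pl_nil.
rewrite !realize_edge_map// => IH; rewrite -(flip_dist (rv i)).
by apply: pl_cons => //; exact: flip01.
Qed.

Lemma realize_continuous : continuous realize.
Proof.
apply: (lipschitz_continuous ltr01) => x y l d /realize_pl_path xy ld.
by rewrite mul1r; apply/gballP; exists l.
Qed.

Lemma realize_closed_edge i : realize @` closed_edge i = closed_edge (fe i).
Proof.
apply/seteqP; split=> [_ [_ [t /= t01 <-] <-]|_ [t /= t01 <-]].
  rewrite in_itv /= in t01; rewrite realize_edge_map//.
  by exists (flip (rv i) t) => //=; rewrite in_itv /=; exact: flip01.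
rewrite in_itv /= in t01; have ft01 := flip01 (rv i) t01.
exists (edge_map i (flip (rv i) t)); last by rewrite realize_edge_map// flipK.
by exists (flip (rv i) t) => //=; rewrite in_itv.
Qed.

Lemma realize_graph_cycle : graph_cycle realize.
Proof.
split; [exact: realize_continuous|by move=> v; exists (f v)|].
by move=> i; exists (fe i); exact: realize_closed_edge.
Qed.

Lemma realize_Inner i u : exists v, realize (Inner i u) = Inner (fe i) v /\
  val v = flip (rv i) (val u).
Proof.
have f01 : 0 < flip (rv i) (val u) < 1.
  by have := inner_itv u; rewrite /flip; case: (rv i) => //; lra.
pose v : {t : R | 0 < t < 1} := exist (fun t : R => is_true (0 < t < 1)) _ f01.
by exists v; split=> //; exact: (edge_map_val (fe i) v).
Qed.

Lemma realize_stub x a al : stub (realize x) a al ->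
  exists2 v, f v = a & stub x v al.
Proof.
case: x => [v|i u].
  move ez : (realize _) => z za; case: za ez => // b [<-].
  by exists v => //; exact: StubVertex.
have [v [-> vu]] := realize_Inner i u.
move ez : (Inner _ v) => z za; case: za ez => // e w [<- <-] {e w}; rewrite vu.
  have := ends i; rewrite /flip; case: (rv i) => -[se te].
    by exists (tgt i); [rewrite se|exact: StubTgt].
  by exists (src i); [rewrite se|exact: StubSrc].
have := ends i; rewrite /flip; case: (rv i) => -[se te].
  by exists (src i); [rewrite te|rewrite subKr; exact: StubSrc].
by exists (tgt i); [rewrite te|exact: StubTgt].
Qed.

(** A route in [X] between two image points lifts to a route in [C] that is
    not longer: the stubs lift because edges map to edges with their
    parametrization ([realize_stub]), and the edge path in between is
    replaced by means of the hypothesis.  A route inside one open edge lifts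
    because [fe] is injective. *)
Lemma realize_isometric : injective fe ->
  (forall v w k, walk (f v) (f w) k ->
     exists2 j, walk v w j & (j <= k)%N) ->
  isometric realize.
Proof.
move=> fe_inj fwalk x y; apply/eqP; rewrite eq_le; apply/andP; split.
  apply: le_ereal_inf_tmp => _ [l xy <-].
  exact/gdist_le/realize_pl_path.
apply: le_ereal_inf_tmp => _ [l /pl_path_route nxy <-].
case: nxy => [e u v xe ye uvl|a b al be k xa yb ab le_l].
  case: x xe => [//|i u'] xe; case: y ye => [//|j v'] ye.
  have [w [wE wu]] := realize_Inner i u'; move: xe; rewrite wE => -[ie uw].
  have [z [zE zv]] := realize_Inner j v'; move: ye; rewrite zE => -[je vz].
  have ij : i = j by apply: fe_inj; rewrite ie je.
  rewrite -ij in zv *; rewrite -!edge_map_val.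
  apply: le_trans (gdist_le (pl_edge _ _ _)) _.
  - by have := inner_itv u'; lra.
  - by have := inner_itv v'; lra.
  by rewrite lee_fin -(flip_dist (rv i)) -wu -zv uw vz.
have [v va xv] := realize_stub xa; have [w wb yw] := realize_stub yb.
rewrite -va -wb in ab; have [j vwj jk] := fwalk _ _ _ ab.
have xy := pl_path_cat (pl_path_cat (stub_pl_path xv) (walk_pl_path R vwj))
  (pl_path_sym (stub_pl_path yw)).
apply: le_trans (gdist_le xy) _; rewrite lee_fin; apply: le_trans le_l.
by rewrite lerD2r lerD2l ler_nat.
Qed.

End Realization.

(** * Polygons are circles *)

Definition polygon (n : nat) : graph := @Graph 'I_n 'I_n id (@ordS n).

Lemma iter_ordS n k (i : 'I_n) : (iter k (@ordS n) i = (i + k) %% n :> nat)%N.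
Proof.
elim: k => [|k IH] /=; first by rewrite addn0 modn_small.
by rewrite IH addnS -[in LHS]addn1 modnDml addn1.
Qed.

Lemma polygon_walk n k (i : 'I_n) : @walk (polygon n) i (iter k (@ordS n) i) k.
Proof.
elim: k => [|k IH]; first exact: walk0.
rewrite -[X in walk _ _ X]addn1; apply: walk_cat IH _; apply: walk1.
by exists (iter k (@ordS n) i); left.
Qed.

Lemma polygon_walk_arcs n (i j : 'I_n) : (i <= j)%N ->
  @walk (polygon n) i j (j - i)%N /\ @walk (polygon n) i j (n - (j - i))%N.
Proof.
move=> ij; have jn := ltn_ord j; split.
  have {1}-> : j = iter (j - i)%N (@ordS n) i.
    by apply: val_inj; rewrite /= iter_ordS subnKC// modn_small.
  exact: polygon_walk.
apply: walk_sym.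
have {1}-> : i = iter (n - (j - i))%N (@ordS n) j.
  apply: val_inj; rewrite /= iter_ordS.
  have -> : (j + (n - (j - i)) = i + n)%N by lia.
  by rewrite modnDr modn_small//; lia.
exact: polygon_walk.
Qed.

Section Circle.
Context (R : realType).
Implicit Types a b t : R.

Lemma cos_lipschitz a b : `|cos a - cos b| <= `|a - b|.
Proof.
wlog ab : a b / b <= a.
  by move=> h; case: (leP b a) => [/h//|/ltW/h]; rewrite distrC [in X in _ <= X]distrC.
have [|c _ ->] := @MVT_segment R cos (fun x => - sin x) b a ab.
  exact: continuous_subspaceT (@continuous_cos R).
by rewrite normrM normrN ler_piMl// sin_max.
Qed.

Lemma sin_lipschitz a b : `|sin a - sin b| <= `|a - b|.
Proof.
have E t : sin t = cos (t - pi / 2) by rewrite cosBpihalf.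
by rewrite !E; apply: le_trans (cos_lipschitz _ _) _; rewrite opprB addrA subrK.
Qed.

Definition cis t : R * R := (cos t, sin t).

(** For [d] half of the difference of the arguments, [cos (2 d) = 1] gives
    [sin d = 0], which is impossible for [0 < d < pi]. *)
Lemma cis_inj a b : 0 <= a < pi *+ 2 -> 0 <= b < pi *+ 2 -> cis a = cis b -> a = b.
Proof.
wlog ab : a b / b <= a.
  by move=> h ha hb; case: (leP b a) => [/h|/ltW/h ba /esym/ba->//]; exact.
move=> /andP[_ a2] /andP[b0 _] [cab sab]; apply/eqP; rewrite eq_le ab andbT leNgt.
apply/negP => ba; set d := (a - b) / 2.
have d1 : cos (d *+ 2) = 1.
  have -> : d *+ 2 = a - b by rewrite -mulr_natr divfK ?pnatr_eq0.
  by rewrite cosB cab sab -!expr2 cos2Dsin2.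
have : 0 < sin d.
  by apply: sin_gt0_pi; rewrite /d; move: a2 b0 ba; clear; lra.
suff : sin d ^+ 2 = 0 by move=> /eqP; rewrite expf_eq0 /= => /eqP ->; rewrite ltxx.
by rewrite sin2cos2; move: d1; rewrite cos_mulr2n -mulr_natr; lra.
Qed.

Lemma cis_surj (p : R * R) : unit_circle p ->
  exists2 t, 0 <= t < pi *+ 2 & cis t = p.
Proof.
case: p => a b; rewrite /unit_circle /= => ab.
have a1 : -1 <= a <= 1.
  by rewrite -ler_norml -(@ler_sqr _ `|a|) ?nnegrE// real_normK ?num_real// expr1n -ab lerDl sqr_ge0.
have := pi_gt0 R => pi0; have := acos_ge0 a1; have := acos_lepi a1 => h1 h0.
have ca : cos (acos a) = a by apply: acosK; rewrite in_itv.
have sa : sin (acos a) = `|b|.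
  by rewrite sin_acos// -ab addrAC subrr add0r sqrtr_sqr.
have [b0|b0] := leP 0 b.
  exists (acos a); first by rewrite h0 /= -mulr_natr; lra.
  by rewrite /cis ca sa ger0_norm.
have h : 0 < acos a.
  rewrite lt_neqAle h0 andbT; apply/eqP => a0; move: sa.
  by rewrite -a0 sin0 => /esym/eqP; rewrite normr_eq0 (lt_eqF b0).
exists (- acos a + pi *+ 2); first by rewrite -mulr_natr; lra.
by rewrite /cis cosD2pi sinD2pi cosN sinN ca sa ltr0_norm// opprK.
Qed.

Context (n : nat) (n0 : (0 < n)%N).
Local Notation P := (polygon n).
Implicit Types x y : gpoint R P.

Definition angle : R := pi *+ 2 / n%:R.

Definition position x : R :=
  match x with
  | Vertex i => (i : 'I_n)%:R
  | Inner i u => (i : 'I_n)%:R + val u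
  end.

Definition wrap x : R * R := cis (angle * position x).

Lemma angle_gt0 : 0 < angle.
Proof. by rewrite divr_gt0 ?ltr0n// mulrn_wgt0// pi_gt0. Qed.

Lemma position_itv x : 0 <= position x < n%:R.
Proof.
case: x => [i|i u]; rewrite /position; first by rewrite ler0n ltr_nat ltn_ord.
have := inner_itv u; have := ler0n R (i : 'I_n).
have : (i : 'I_n).+1%:R <= n%:R :> R by rewrite ler_nat.
by rewrite -natr1; lra.
Qed.

(** The position of a point has its vertex or edge as integral part and its
    parameter as fractional part. *)
Lemma position_inj : injective position.
Proof.
have nat_gap (i j : nat) (s t : R) : 0 <= s < 1 -> 0 <= t < 1 ->
    i%:R + s = j%:R + t -> i = j.
  move=> s01 t01 e; apply/eqP; rewrite eqn_leq -ltnS -[(j <= i)%N]ltnS.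
  by rewrite -!(ltr_nat R) -!natr1; lra.
move=> [i|i u] [j|j v]; rewrite /position => e.
- by congr Vertex; apply: val_inj; apply: (nat_gap _ _ 0 0); lra.
- have v01 := inner_itv v; have ij : (i = j :> nat) by apply: (nat_gap _ _ 0 (val v)); lra.
  by exfalso; move: e; rewrite ij; lra.
- have u01 := inner_itv u; have ij : (i = j :> nat) by apply: (nat_gap _ _ (val u) 0); lra.
  by exfalso; move: e; rewrite ij; lra.
have u01 := inner_itv u; have v01 := inner_itv v.
have ij : (i = j :> nat) by apply: (nat_gap _ _ (val u) (val v)); lra.
have uv : u = v by apply: val_inj; move: e; rewrite ij => /addrI.
by rewrite uv; congr Inner; apply: val_inj.
Qed.

Lemma wrap_inj : injective wrap.
Proof.
move=> x y /cis_inj e; apply: position_inj.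
apply: (@mulfI _ angle); first by rewrite gt_eqF// angle_gt0.
have h z : 0 <= angle * position z < pi *+ 2.
  have /andP[z0 zn] := position_itv z; rewrite mulr_ge0 ?(ltW angle_gt0)//=.
  by rewrite /angle mulrAC ltr_pdivrMr ?ltr0n// ltr_pM2l// mulrn_wgt0// pi_gt0.
exact: e.
Qed.

(** The formula reaches the end [t = 1] of the last edge by periodicity,
    whereas [position] jumps back to [0] there. *)
Lemma wrap_edge_map (i : 'I_n) t : 0 <= t <= 1 ->
  wrap (@edge_map R P i t) = cis (angle * (i%:R + t)).
Proof.
move=> /(@edge_mapP R P i)-[||u]; rewrite /wrap //= ?addr0//.
have := ltn_ord i; rewrite leq_eqVlt => /predU1P[ni|ni]; last by rewrite modn_small// natr1.
have an : angle * n%:R = pi *+ 2 by rewrite divfK// pnatr_eq0 -lt0n.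
rewrite natr1 ni modnn mulr0 an /cis.
by have := cosD2pi (0 : R); have := sinD2pi (0 : R); rewrite add0r => -> ->.
Qed.

Lemma wrap_surj p : unit_circle p -> exists x, wrap x = p.
Proof.
move=> /cis_surj[t /andP[t0 t2] <-].
have v0 : 0 <= t / angle by rewrite divr_ge0// ltW// angle_gt0.
have vn : t / angle < n%:R.
  by rewrite ltr_pdivrMr ?angle_gt0// mulrC divfK// pnatr_eq0 -lt0n.
have := truncn_itv v0; set k := Num.truncn _ => kv.
have kn : (k < n)%N by rewrite truncn_lt_nat.
exists (@edge_map R P (Ordinal kn) (t / angle - k%:R)).
rewrite wrap_edge_map; last by move: kv; rewrite -natr1; lra.
by rewrite /= addrC subrK mulrC divfK// gt_eqF// angle_gt0.
Qed.

Lemma wrap_lipschitz x y l : pl_path x y l ->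
  `|(wrap x).1 - (wrap y).1| <= angle * l /\ `|(wrap x).2 - (wrap y).2| <= angle * l.
Proof.
elim=> [z|i s t z m s01 t01 _ [IH1 IH2]]; first by rewrite !subrr normr0 mulr0.
rewrite mulrDr; split.
  apply: le_trans (ler_distD (wrap (edge_map i t)).1 _ _) (lerD _ IH1).
  rewrite !wrap_edge_map// (le_trans (cos_lipschitz _ _))//.
  by rewrite -mulrBr normrM gtr0_norm ?angle_gt0// opprD addrACA subrr add0r.
apply: le_trans (ler_distD (wrap (edge_map i t)).2 _ _) (lerD _ IH2).
rewrite !wrap_edge_map// (le_trans (sin_lipschitz _ _))//.
by rewrite -mulrBr normrM gtr0_norm ?angle_gt0// opprD addrACA subrr add0r.
Qed.

Lemma wrap_continuous : continuous wrap.
Proof.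
apply: (@lipschitz_continuous R P _ wrap angle angle_gt0) => x y l d.
move=> /wrap_lipschitz[h1 h2] ld.
have ad : angle * l < angle * d by rewrite ltr_pM2l ?angle_gt0.
by split; rewrite /ball /= /ball_; [exact: le_lt_trans h1 ad|exact: le_lt_trans h2 ad].
Qed.

Lemma polygon_compact : compact [set: gpoint R P].
Proof.
have -> : [set: gpoint R P] =
    \big[setU/set0]_(i <- enum 'I_n) (@closed_edge R P i).
  rewrite -bigcup_seq; apply/esym/seteqP; split=> // -[i|i u] _;
    exists i => //=; rewrite ?mem_enum//.
    by exists 0; rewrite ?edge_map0//= in_itv /= lexx ler01.
  exists (val u); last exact: edge_map_val.
  by have /andP[u0 u1] := inner_itv u; rewrite /= in_itv /= !ltW.
by apply: bigsetU_compact => i _; exact: compact_closed_edge.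
Qed.

(** The wrapping map is a continuous bijection from a compact space onto the
    circle, which is Hausdorff, so that it is closed and its inverse is
    continuous. *)
Lemma polygon_circle : circle_graph R P.
Proof.
have [g gP] : {g : R * R -> gpoint R P & forall p, unit_circle p -> wrap (g p) = p}.
  apply: (@choice _ _ (fun p x => unit_circle p -> wrap x = p)) => p.
  have [/wrap_surj[x xp]|np] := pselect (unit_circle p); first by exists x.
  by exists (Vertex R (Ordinal n0 : vert P)).
have wrap_circle x : unit_circle (wrap x).
  by rewrite /unit_circle /= cos2Dsin2.
exists wrap, g; split.
- exact: wrap_continuous.
- apply/continuous_closedP => Z cZ; apply/closed_subspaceP.
  exists (wrap @` Z).
    apply: compact_closed; first exact: norm_hausdorff.
    apply: continuous_compact; first exact: continuous_subspaceT wrap_continuous.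
    exact: subclosed_compact cZ polygon_compact _.
  apply/seteqP; split=> [_ [[x Zx <-] _]|p [Zp cp]].
    split; last exact: wrap_circle.
    have gx : g (wrap x) = x := wrap_inj (gP _ (wrap_circle x)).
    by change (Z (g (wrap x))); rewrite gx.
  by split=> //; exists (g p) => //; exact: gP.
- apply/seteqP; split=> [_ [x _ <-]//|p /wrap_surj[x <-]]; by exists x.
- by move=> x; apply: wrap_inj; exact: gP.
Qed.

End Circle.

(** * Long closed paths have shortcuts *)

Lemma last_take (T : Type) (x : T) p i : (i <= size p)%N ->
  last x (take i p) = nth x (x :: p) i.
Proof.
move=> ip; rewrite (last_nth x) size_takel//.
by case: i ip => //= i ip; rewrite nth_take.
Qed.

(** In a cycle of length at least [3], two vertices are not each other's
    successors; hence an edge is determined by its two ends. *)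
Lemma ordS_ordS n (a b : 'I_n) : (2 < n)%N -> a = ordS b -> b = ordS a -> False.
Proof.
move=> n2 /(congr1 val) /= + /(congr1 val) /=.
have := ltn_ord b; rewrite leq_eqVlt => /predU1P[bn|bn];
have := ltn_ord a; rewrite leq_eqVlt => /predU1P[an|an];
by rewrite ?bn ?an ?modnn ?modn_small//; lia.
Qed.

Section Shortcuts.
Context (R : realType) (X : graph).

Lemma walk_shortcut x p i j k : (i <= j <= size p)%N ->
  walk (nth x (x :: p) i) (nth x (x :: p) j) k ->
  (k < minn (j - i) (size p - (j - i)))%N -> has_shortcut (@adjb X) x p.
Proof.
move=> /andP[ij jp] [q [xq lq qk]] klt.
exists (take i p), (drop i (take j p)), (drop j p), q.
have E : take i p ++ drop i (take j p) = take j p.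
  by rewrite -{1}(@take_takel _ i j)// cat_take_drop.
split.
- by rewrite catA E cat_take_drop.
- by rewrite last_take// (leq_trans ij).
- by rewrite E !last_take// (leq_trans ij).
by rewrite !size_drop !size_takel//; lia.
Qed.

(** A closed path with [n] edges and no shortcut defines a graph map from the
    [n]-gon which does not decrease the distances of vertices, since the
    distance of [i <= j] in the [n]-gon is the minimum of [j - i] and [n - (j
    - i)].  So it is an isometric cycle, and [n <= theta].  The summand [2]
    excludes closed paths of length at most [2], which may run back and forth
    along a single edge. *)
Lemma closed_path_shortcut (theta : nat) :
  (forall (C : graph) (f : gpoint R C -> gpoint R X),
     circle_graph R C -> graph_cycle f -> isometric f ->
     ([set: edge C] #<= `I_theta)%card) ->
  forall x p, path (@adjb X) x p -> last x p = x -> (theta + 2 < size p)%N ->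
  has_shortcut (@adjb X) x p.
Proof.
move=> short x p xp lxp; set n := size p => np; apply: contrapT => nos.
have n0 : (0 < n)%N by lia.
pose f (i : vert (polygon n)) : vert X := nth x (x :: p) (i : 'I_n).
have arcs (i j : 'I_n) k : walk (f i) (f j) k ->
    exists2 l, @walk (polygon n) i j l & (l <= k)%N.
  wlog ij : i j / (i <= j)%N.
    move=> h; case: (leqP i j) => [/h//|/ltnW/h {}h /walk_sym/h[l /walk_sym ?]].
    by exists l.
  move=> ijk; have [w1 w2] := polygon_walk_arcs ij.
  have jn := ltn_ord j.
  case: (ltnP k (minn (j - i) (n - (j - i)))) => [klt|].
    by case: nos; apply: (walk_shortcut (i := i) (j := j)) ijk klt; lia.
  rewrite geq_min => /orP[le_k|le_k]; [by exists (j - i)%N|by exists (n - (j - i))%N].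
have f_inj : injective f.
  move=> i j fij; have [|l [q [_ <- ql]]] := arcs i j 0%N.
    by rewrite fij; exact: walk0.
  by rewrite leqn0 -ql size_eq0 => /eqP->.
have fS (i : 'I_n) : joined (f i) (f (ordS i)).
  have /(pathP x) /(_ i (ltn_ord i)) /asboolP := xp.
  suff -> : nth x p i = f (ordS i) by [].
  rewrite /f /=; have := ltn_ord i; rewrite leq_eqVlt => /predU1P[ni|ni].
    have -> : (i : nat) = n.-1 by rewrite -{2}ni.
    by rewrite /n nth_last lxp prednK// modnn.
  by rewrite modn_small.
have [fe feP] := choice fS.
pose rv i : bool := `[< src (fe i) <> f i >].
have ends : @preserves_ends (polygon n) X f fe rv.
  move=> i; rewrite /rv; case: asboolP => [si|/contrapT si].
    by have [[]|[]] := feP i.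
  have [[//]|[s t]] := feP i.
  by rewrite si; split=> //; rewrite t -si s.
have fe_inj : injective fe.
  move=> i j ij; apply: contrapT => nij.
  have two (a b : 'I_n) : a = ordS b -> b = ordS a -> False.
    by apply: ordS_ordS; lia.
  have := feP i; have := feP j; rewrite -ij.
  case=> -[s t] [[s' t']|[s' t']].
  - by apply: nij; apply: f_inj; rewrite -s -s'.
  - by apply: (two i j); apply: f_inj; [rewrite -t -t'|rewrite -s -s'].
  - by apply: (two i j); apply: f_inj; [rewrite -s -s'|rewrite -t -t'].
  - by apply: nij; apply: f_inj; rewrite -t -t'.
have iso : isometric (@realize R _ _ f fe rv) by exact: realize_isometric.
have := short _ _ (polygon_circle R n0) (realize_graph_cycle R ends) iso.
rewrite -(card_le_eql card_II) card_le_II; lia.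
Qed.

End Shortcuts.

(** * Proper cocompact actions on shortcut graphs *)

(** The parameter [1/2] is fixed by the reversal of an edge, so midpoints go
    to midpoints in both cases.  They are the points by which edges are
    located. *)
Lemma automorphism_edge (R : realType) (X : graph)
    (phi : gpoint R X -> gpoint R X) (f : vert X -> vert X) (e : edge X) :
  graph_automorphism phi -> (forall v, phi (Vertex R v) = Vertex R (f v)) ->
  exists e', phi (midpoint R e) = midpoint R e' /\
    ((f (src e) = src e' /\ f (tgt e) = tgt e') \/
     (f (src e) = tgt e' /\ f (tgt e) = src e')).
Proof.
move=> [_ _ phiE] phiV; have [e' he'] := phiE e; exists e'.
have i0 : 0 \in `[(0 : R), 1]%R by rewrite in_itv /= lexx ler01.
have i1 : 1 \in `[(0 : R), 1]%R by rewrite in_itv /= lexx ler01.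
have ih : (1 / 2) \in `[(0 : R), 1]%R by rewrite in_itv /=; lra.
rewrite -!edge_map_half.
case: he' => he'; have := he' _ i0; have := he' _ i1; have -> := he' _ ih.
  rewrite !edge_map0 !edge_map1 !phiV => -[t] [s]; split=> //; by left.
rewrite subr0 subrr !edge_map0 !edge_map1 !phiV => -[t] [s].
by split; [congr edge_map; lra|right].
Qed.

Theorem theoremA (R : realType) (G : groupType) :
  shortcut_group R G -> finitely_presented G.
Proof.
move=> [X [act [[X0 Xconn _ [theta short]] [act1 actM actA] proper [K cK KT]]]].
have [v0 _] : exists v : vert X, True.
  by case: X0 => -[v|e u] _; [exists v|exists (src e)].
have [av avP] : {av : G -> vert X -> vert X &
    forall g v, act g (Vertex R v) = Vertex R (av g v)}.
  have [h hP] : {h : G * vert X -> vert X &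
      forall gv, act gv.1 (Vertex R gv.2) = Vertex R (h gv)}.
    apply: (@choice _ _ (fun gv w => act gv.1 (Vertex R gv.2) = Vertex R w)).
    by move=> [g v]; have [_ /(_ v)] := actA g.
  by exists (fun g v => h (g, v)) => g v; exact: (hP (g, v)).
have avM g h v : av (g * h)%g v = av g (av h v).
  suff [] : Vertex R (av (g * h)%g v) = Vertex R (av g (av h v)) by [].
  by rewrite -!avP actM.
have av1 v : av 1%g v = v.
  by suff [] : Vertex R (av 1%g v) = Vertex R v by []; rewrite -avP act1.
have avE g e := automorphism_edge e (actA g) (avP g).
have reach z : exists2 g, K (act g z) & True.
  have : (\bigcup_g (act g @` K)) z by rewrite KT.
  by move=> [g _ [w Kw <-]]; exists g^-1%g; rewrite // -actM mulVg act1.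
(* Translates of [K] cover all midpoints, hence translates of the ends of the
   edges in [M] cover all edges.  The vertex [v0] only serves as a base point. *)
pose M := [set e : edge X | K (midpoint R e)].
pose F := [set v | K (Vertex R v)] `|` (@src X @` M `|` @tgt X @` M) `|` [set v0].
have finF : finite_set F.
  have finM : finite_set M.
    by apply: (finite_separated _ cK) => a b; exact: gball_midpoint.
  rewrite !finite_setU; do !split; try exact: finite_image; last exact: finite_set1.
  by apply: (finite_separated _ cK) => a b; exact: gball_vertex.
apply: (@finitely_presented_of_shortcuts G (vert X) av (@adjb X) F v0 (theta + 2)).
- exact: av1.
- exact: avM.
- exact: adjb_sym.
- move=> g u v /asboolP[e uv]; apply/asboolP; have [e' [_ ee']] := avE g e.
  by exists e'; case: uv => -[<- <-]; case: ee' => -[-> ->]; [left|right|right|left].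
- move=> u v; have [k [p [up lp _]]] := connected_walk Xconn u v.
  by exists p.
- have cF : compact (@Vertex R X @` F).
    by apply: finite_compact; exact: finite_image.
  apply: sub_finite_set (proper _ cF) => g [a [b [Fa Fb ab]]].
  exists (Vertex R b); split; last by exists b.
  by exists (Vertex R a); [exists a|rewrite avP ab].
- by right.
- move=> v; have [g Kg _] := reach (Vertex R v).
  exists g^-1%g, (av g v); split; last by rewrite -avM mulVg av1.
  by left; left; rewrite /= -avP.
- move=> u v /asboolP[e uv]; have [g Kg _] := reach (midpoint R e).
  have [e' [ge ee']] := avE g e; have Me' : M e' by rewrite /M /= -ge.
  have Fs : F (src e') by left; right; left; exists e'.
  have Ft : F (tgt e') by left; right; right; exists e'.
  exists g^-1%g, (av g u), (av g v); rewrite -!avM mulVg !av1.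
  by case: uv => -[<- <-]; case: ee' => -[-> ->].
- exact: (@closed_path_shortcut R X theta short).
Qed.
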